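(* Let $K$ be a subfield of $\mathbb{R}$ and let $\alpha,\beta\in K$ with $\alpha,\beta>0$ and $\log_{\alpha}(\beta)\notin\mathbb{Q}$. Then the structure $(K,\alpha^{\mathbb{Z}},\beta^{\mathbb{Z}})$ defines $\mathbb{Z}$.
   Context: For $\gamma\in K^{\times}$, $\gamma^{\mathbb{Z}}=\{\gamma^k: k\in\mathbb{Z}\}$. $K$ is regarded as an ordered field with the order induced from $\mathbb{R}$, and $(K,\alpha^{\mathbb{Z}},\beta^{\mathbb{Z}})$ is its expansion by unary predicates for these two sets. Definable means definable with parameters. *)

(* Defs.v *)
From HB Require Import structures.
From mathcomp Require Import all_boot all_order all_algebra.
From mathcomp Require Import all_classical all_reals all_analysis.

Set Implicit Arguments.
Unset Strict Implicit.
Unset Printing Implicit Defensive.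

Import Order.TTheory GRing.Theory Num.Theory.

Local Open Scope classical_set_scope.
Local Open Scope ring_scope.

(** A subfield of [R] is a [K : divringClosed R]: a predicate containing 1 and
    closed under subtraction and division.  [subfield K] is the type of its
    elements, with the field structure and the order induced from [R], so that
    [x <= y] in [subfield K] is convertible to [\val x <= \val y] in [R]. *)

Section Subfield.
Variables (R : realType) (K : divringClosed R).

Record subfield := Subfield { subfield_val : R; _ : subfield_val \in K }.

HB.instance Definition _ := [isSub for subfield_val].
HB.instance Definition _ := [Choice of subfield by <:].
HB.instance Definition _ := [SubChoice_isSubIntegralDomain of subfield by <:].
HB.instance Definition _ := [SubIntegralDomain_isSubField of subfield by <:].

Let le (x y : subfield) : bool := \val x <= \val y.
Let lt (x y : subfield) : bool := \val x < \val y.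
Let norm (x : subfield) : subfield := if le 0 x then x else - x.

Let le0_add x y : le 0 x -> le 0 y -> le 0 (x + y).
Proof. by rewrite /le rmorph0 rmorphD; exact: addr_ge0. Qed.

Let le0_mul x y : le 0 x -> le 0 y -> le 0 (x * y).
Proof. by rewrite /le rmorph0 rmorphM; exact: mulr_ge0. Qed.

Let le0_anti x : le 0 x -> le x 0 -> x = 0.
Proof. by rewrite /le => x0 x0'; apply/val_inj/le_anti; rewrite x0 x0'. Qed.

Let sub_ge0 x y : le 0 (y - x) = le x y.
Proof. by rewrite /le rmorph0 rmorphB /= subr_ge0. Qed.

Let le0_total x : le 0 x || le x 0.
Proof. exact: le_total. Qed.

Let normN x : norm (- x) = norm x.
Proof.
rewrite /norm /le rmorph0 rmorphN /= oppr_ge0.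
case: (ltgtP (\val x) 0) => [||x0]; rewrite ?opprK //.
have -> : x = 0 by apply: val_inj; rewrite x0 rmorph0.
by rewrite oppr0.
Qed.

Let ge0_norm x : le 0 x -> norm x = x.
Proof. by rewrite /norm => ->. Qed.

Let lt_def x y : lt x y = (y != x) && le x y.
Proof. by rewrite /lt lt_def -(inj_eq val_inj). Qed.

HB.instance Definition _ := Num.IntegralDomain_isLeReal.Build subfield
  le0_add le0_mul le0_anti sub_ge0 le0_total normN ge0_norm lt_def.

End Subfield.

(** First-order formulas in the language of ordered rings expanded by two unary
    predicate symbols; variables are de Bruijn indices. *)

Inductive term : Type :=
  | TVar of nat
  | TZero
  | TOne
  | TAdd of term & term
  | TOpp of term
  | TMul of term & term.

Inductive formula : Type :=
  | FEq of term & term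
  | FLt of term & term
  | FPredA of term
  | FPredB of term
  | FNot of formula
  | FAnd of formula & formula
  | FOr of formula & formula
  | FImp of formula & formula
  | FExists of formula
  | FForall of formula.

Definition scons (T : Type) (x : T) (e : nat -> T) (i : nat) : T :=
  if i is j.+1 then e j else x.

Section Semantics.
Variables (M : realFieldType) (A B : set M).

Fixpoint eval (e : nat -> M) (t : term) : M :=
  match t with
  | TVar i => e i
  | TZero => 0
  | TOne => 1
  | TAdd t1 t2 => eval e t1 + eval e t2
  | TOpp t1 => - eval e t1
  | TMul t1 t2 => eval e t1 * eval e t2
  end.

Fixpoint sat (e : nat -> M) (f : formula) : Prop :=
  match f with
  | FEq t1 t2 => eval e t1 = eval e t2
  | FLt t1 t2 => eval e t1 < eval e t2
  | FPredA t => A (eval e t)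
  | FPredB t => B (eval e t)
  | FNot f1 => ~ sat e f1
  | FAnd f1 f2 => sat e f1 /\ sat e f2
  | FOr f1 f2 => sat e f1 \/ sat e f2
  | FImp f1 f2 => sat e f1 -> sat e f2
  | FExists f1 => exists x : M, sat (scons x e) f1
  | FForall f1 => forall x : M, sat (scons x e) f1
  end.

(** Definability with parameters of a subset of [M] in the structure [(M, A, B)]:
    variable 0 is the argument and [e] supplies the parameters, of which only
    the finitely many that occur in [f] matter. *)
Definition definable (S : set M) : Prop :=
  exists (f : formula) (e : nat -> M), S = [set x | sat (scons x e) f].

End Semantics.

Definition zpowers (M : realFieldType) (g : M) : set M :=
  [set x | exists k : int, x = g ^ k].

Definition integers (M : realFieldType) : set M :=
  [set x | exists k : int, x = k%:~R].

(** Since [ln 1 = 0] and [0^-1 = 0], [logb 1 b = 0]; the base 1 is thus excluded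
    by requiring [logb a b] to be irrational. *)
Definition logb (R : realType) (a b : R) : R := ln b / ln a.

(* Main.v *)
Require Import Defs.
From HB Require Import structures.
From mathcomp Require Import all_boot all_order all_algebra.
From mathcomp Require Import all_classical all_reals all_analysis.
From mathcomp Require Import lra zify ring.

Set Implicit Arguments.
Unset Strict Implicit.
Unset Printing Implicit Defensive.

Import Order.TTheory GRing.Theory Num.Theory.
Local Open Scope classical_set_scope.
Local Open Scope ring_scope.

(** Replacing generators by their inverses, take [a, b > 1], and let [f k] be the
    representative of [a ^+ k] modulo [b^Z] in the interval from 1 (included) to
    [b] (excluded).  Irrationality makes the values of [f] at large arguments
    dense in that interval.

    Fix [e] and let [e' < e] run over the best approximations of [f e] from below.
    The scales [d], with [a^-(d+1) <= f e - f e' < a^-d], form a finite set, the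
    records of [e].  If [e0] is given and [d] is large, then any large [e1] with
    [f e0 + a^-(d+1) < f e1 < f e0 + a^-d] has the same records below [d] as [e0],
    has the record [d], and has uncontrolled records above [d].  Two codes [e] and
    [s], extended in turn, separate the chosen records from the others: a record
    [d] of [e] is chosen (flagged) when it is preceded by a record of [s] with no
    record of [e] in between.  Hence every set [d_0 < ... < d_n] that grows fast
    enough is the set of flagged records of some [(e, s)], and by density we may
    take [f d_i] as close as we like to [1 + i * eta].

    Conversely, suppose that each flagged [d] has [f d] near [1], or near
    [f d' + eta] for a flagged [d' < d] with an error below [eps * eta / a ^+ d'].
    The errors add up to a geometric series, so [f d] is within [O(eps * eta)] of
    [1 + k * eta] for some natural [k].  Thus [x] is natural iff for all [eps > 0]
    some [(e, s, eta)] of this kind has a flagged [d] with [f d] within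
    [eps * eta] of [1 + x * eta].  This is a first-order condition, because an
    exponent [k] can be represented by [a ^+ k]. *)

(** * Coding finite sets of exponents *)

Definition for_large (P : nat -> Prop) := exists N, forall d, (N <= d)%N -> P d.

Lemma for_large_and (P Q : nat -> Prop) :
  for_large P -> for_large Q -> for_large (fun d => P d /\ Q d).
Proof.
move=> [m Pm] [n Qn]; exists (maxn m n) => d; rewrite geq_max => /andP[md nd].
by split; [exact: Pm | exact: Qn].
Qed.

Lemma for_large_forall_lt n (Q : nat -> nat -> Prop) :
  (forall e, (e < n)%N -> for_large (Q e)) ->
  for_large (fun d => forall e, (e < n)%N -> Q e d).
Proof.
elim: n => [_|n IHn Qn]; first by exists 0%N.
have [N1 Q1] := IHn (fun e en => Qn e (ltnW en)).
have [N2 Q2] := Qn n (ltnSn n).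
exists (maxn N1 N2) => d; rewrite geq_max => /andP[N1d N2d] e.
by rewrite ltnS leq_eqVlt => /orP[/eqP->|en]; [exact: Q2 | exact: Q1].
Qed.

Section Flags.
Variable record : nat -> nat -> Prop.

Definition flagged (e s d : nat) : Prop := record e d /\
  exists v, [/\ record s v, (v < d)%N &
    forall w, record e w -> ~ ((v <= w)%N /\ (w < d)%N)].

Hypothesis record_extend : forall e0, exists N,
  (forall d, record e0 d -> (d < N)%N) /\
  forall d, (N <= d)%N -> exists e1, forall x, (x <= d)%N ->
    (record e1 x <-> record e0 x \/ x = d).

(** Extend [s] by an exponent [v] beyond all records of both codes, then [e] by [d] beyond all
    records of the new [s']. Then [v] flags [d], while [d] separates every later record of [e'] from
    the records of [s'], so none of those is flagged. *)
Lemma flagged_extend e s : exists N, (forall x, flagged e s x -> (x < N)%N) /\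
  forall d, (N <= d)%N -> exists e' s', forall x,
    (flagged e' s' x <-> flagged e s x \/ x = d).
Proof.
have [Ne [eN eext]] := record_extend e.
have [Ns [sN sext]] := record_extend s.
pose v := maxn Ne Ns.
have [s' s'P] := sext v (leq_maxr _ _).
have [Ns' [s'N _]] := record_extend s'.
exists (maxn v.+1 Ns'); split=> [x [/eN xN _]|d].
  by rewrite /v; lia.
rewrite geq_max => /andP[vd Nd].
have [e' e'P] := eext d ltac:(rewrite /v in vd; lia).
have e'd : record e' d by apply/e'P => //; right.
exists e', s' => x; split.
  move=> [e'x [y [s'y yx yw]]].
  have [xd|xd|->] := ltngtP x d; last by right.
    have [ex|?] : record e x \/ x = d by apply/e'P => //; exact: ltnW.
      left; split=> //; exists y; split=> //.
        have [//|yv] : record s y \/ y = v.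
          by apply/s'P => //; have := eN _ ex; rewrite /v; lia.
        by have := eN _ ex; rewrite /v in yv; lia.
      move=> w ew [yw1 wx]; apply: (yw w _ (conj yw1 wx)).
      by apply/e'P; [lia|left].
    by lia.
  by have ? := s'N _ s'y; case: (yw d e'd); split; lia.
move=> [[ex [y [sy yx yw]]]|->].
  have xN := eN _ ex; split; first by apply/e'P; [rewrite /v in vd; lia|left].
  exists y; split=> //.
    by apply/s'P; [have := sN _ sy; rewrite /v; lia|left].
  move=> w e'w [yw1 wx]; apply: (yw w _ (conj yw1 wx)).
  have [//|] : record e w \/ w = d by apply/e'P => //; rewrite /v in vd; lia.
  by rewrite /v in vd; lia.
split=> //; exists v; split=> //; first by apply/s'P => //; right.
move=> w e'w [vw wd].
have [/eN|] : record e w \/ w = d by apply/e'P => //; exact: ltnW.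
  by rewrite /v in vw; lia.
by lia.
Qed.

End Flags.

(** * Codes from best approximations, and counting with them *)

Section Codes.
Variables (M : realFieldType) (a b : M) (f : nat -> M).

Definition record (e d : nat) : Prop := exists e', [/\ (e' < e)%N, f e' < f e,
  forall e'', (e'' < e')%N -> ~ (f e' < f e'' /\ f e'' < f e),
  a ^+ d * (f e - f e') < 1 & 1 <= a * a ^+ d * (f e - f e')].

Local Notation flagged := (flagged record).

Definition chained (e s : nat) (tol eta : M) : Prop :=
  forall d, flagged e s d -> `|f d - 1| < tol \/
  exists d', [/\ flagged e s d', (d' < d)%N &
    a ^+ d' * `|f d - f d' - eta| < tol].

(** The strict bound on a norm makes [eps * eta] positive, so [eps > 0] forces [eta > 0]. *)
Definition counts_to (eps x : M) : Prop := exists e s eta,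
  chained e s (eps * eta) eta /\
  (exists2 d, flagged e s d & `|f d - 1 - x * eta| < eps * eta).

Hypothesis a_gt1 : 1 < a.

Let a_gt0 : 0 < a. Proof. exact: lt_trans ltr01 a_gt1. Qed.
Let aX_gt0 d : 0 < a ^+ d. Proof. exact: exprn_gt0. Qed.

(* [C - c / a ^+ d] with [c = a / (a - 1)] bounds the errors made up to [d],
   because [c / a ^+ d' - c / a ^+ d >= 1 / a ^+ d'] for [d' < d]. *)
Lemma flagged_near_multiple e s eps eta : 0 < eps * eta ->
  chained e s (eps * eta) eta ->
  forall d, flagged e s d -> exists k : nat,
    `|f d - 1 - k%:R * eta| <= eps * eta * (1 + a / (a - 1) * (1 - (a ^+ d)^-1)).
Proof.
move=> h0 chain; have ? : 0 < a / (a - 1) by rewrite divr_gt0 ?subr_gt0.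
elim/ltn_ind=> d IHd Fd; have [base|[d' [Fd' d'd step]]] := chain d Fd.
  exists 0%N; rewrite mul0r subr0; apply: (le_trans (ltW base)).
  rewrite ler_peMr ?(ltW h0)// lerDl pmulr_rge0// subr_ge0.
  by rewrite invf_le1 ?exprn_ege1 // ltW.
have [k kP] := IHd _ d'd Fd'; exists k.+1.
have -> : f d - 1 - k.+1%:R * eta = (f d - f d' - eta) + (f d' - 1 - k%:R * eta).
  by rewrite -natr1; ring.
apply: (le_trans (ler_normD _ _)); rewrite mulrC -ltr_pdivlMr// in step.
apply: (le_trans (lerD (ltW step) kP)); rewrite -mulrDr ler_pM2l//.
set x := (a ^+ d')^-1.
have x0 : 0 < x by rewrite invr_gt0.
have : (a ^+ d)^-1 <= x / a.
  rewrite -invfM -exprSr lef_pV2 ?posrE ?exprn_gt0// ler_weXn2l// ?ltW//.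
rewrite -(ler_pM2l (x := a / (a - 1)))// => h.
have : a / (a-1) * (x / a) = a / (a - 1) * x - x.
  by field; rewrite subr_eq0 !gt_eqF.
lra.
Qed.

Lemma counts_to_nat x : (forall eps, 0 < eps -> counts_to eps x) ->
  exists k : nat, x = k%:R.
Proof.
(* [C * eps * eta] bounds the sum of both errors: at most [1 + a / (a - 1)] times [eps * eta]
   between [f d] and the progression, and [eps * eta] between [f d] and [1 + x * eta]. *)
move=> cx; pose C := 2 + a / (a - 1).
have C0 : 0 < C by rewrite addr_gt0// divr_gt0 ?subr_gt0.
have near r : 0 < r -> exists k : nat, `|x - k%:R| < r.
  move=> r0; have rC : 0 < r / C by rewrite divr_gt0.
  have [e [s [eta [chain [d Fd dx]]]]] := cx _ rC.
  have h0 : 0 < r / C * eta by exact: le_lt_trans dx.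
  have eta0 : 0 < eta by rewrite pmulr_rgt0 in h0.
  have [k kP] := flagged_near_multiple h0 chain Fd; exists k.
  rewrite -(ltr_pM2r eta0) -[X in _ * X < _](gtr0_norm eta0) -normrM.
  have -> : (x - k%:R) * eta = (f d - 1 - k%:R * eta) - (f d - 1 - x * eta).
    by ring.
  apply: (le_lt_trans (ler_normB _ _)); apply: (lt_le_trans (ler_ltD kP dx)).
  have -> : r * eta = r / C * eta * C by field; rewrite gt_eqF.
  rewrite -[X in _ + X]mulr1 -mulrDr ler_pM2l// /C.
  have : 0 < a / (a - 1) / a ^+ d by rewrite !(divr_gt0, mulr_gt0) ?subr_gt0.
  lra.
(* A second natural [l], more than twice as close to [x] as [k], cannot equal [k], yet is less than
   1 away from it. *)
have [k kx] := near (1 / 2) ltac:(lra); exists k; apply/eqP; apply: contraT => xk.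
have xk0 : 0 < `|x - k%:R| by rewrite normr_gt0 subr_eq0.
have [l lx] := near (`|x - k%:R| / 2) ltac:(lra).
have : `|k%:R - l%:R : M| < 1.
  have -> : k%:R - l%:R = (x - l%:R) - (x - k%:R) :> M by ring.
  by apply: (le_lt_trans (ler_normB _ _)); lra.
have [/eqP kl|kl] := boolP (k == l); first by move: lx; rewrite -kl; lra.
move: kl; rewrite neq_ltn => /orP[] kl.
  by rewrite distrC -natrB ?(ltnW kl)// normr_nat ltrn1 ltnS leqn0
    subn_eq0 leqNgt kl.
by rewrite -natrB ?(ltnW kl)// normr_nat ltrn1 ltnS leqn0
    subn_eq0 leqNgt kl.
Qed.

Hypothesis aX_unbounded : forall x, exists d, x < a ^+ d.
Hypothesis f_ge1 : forall k, 1 <= f k.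
Hypothesis f_ltb : forall k, f k < b.
Hypothesis f_inj : injective f.
Hypothesis f_dense : forall p q N, 1 <= p -> p < q -> q <= b ->
  exists2 k, (N <= k)%N & p < f k < q.

Lemma for_large_aXV_lt x : 0 < x -> for_large (fun d => (a ^+ d)^-1 < x).
Proof.
move=> x0; have [N xN] := aX_unbounded x^-1; exists N => d Nd.
rewrite -[ltRHS]invrK ltf_pV2 ?posrE ?invr_gt0//; apply: (lt_le_trans xN).
by rewrite ler_weXn2l// ltW.
Qed.

(** For large [d], no earlier value lies above [f e0] within [(a ^+ d)^-1], and raising [f e0] by
    less than that changes the scale of no earlier approximation from below. So [e1] keeps those
    records and gains [d] from [e0], and indices after [e0] give scales at least [d]. *)
Lemma record_extend e0 : exists N, (forall d, record e0 d -> (d < N)%N) /\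
  forall d, (N <= d)%N -> exists e1, forall x, (x <= d)%N ->
    (record e1 x <-> record e0 x \/ x = d).
Proof.
have evb : for_large (fun d => (a ^+ d)^-1 < b - f e0).
  by apply: for_large_aXV_lt; rewrite subr_gt0.
have evgt e : (e < e0)%N ->
    for_large (fun d => f e0 < f e -> f e0 + (a ^+ d)^-1 < f e).
  move=> _; have [h|h] := ltP (f e0) (f e); last by exists 0%N.
  have [N NP] := @for_large_aXV_lt (f e - f e0) ltac:(lra).
  by exists N => d /NP; lra.
have evlt e : (e < e0)%N -> for_large (fun d => f e < f e0 ->
    forall k, a ^+ k * (f e0 - f e) < 1 ->
    (k < d)%N /\ a ^+ k * (f e0 + (a ^+ d)^-1 - f e) <= 1).
  move=> _; have [h|h] := ltP (f e) (f e0); last by exists 0%N.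
  (* Only [k < K] can satisfy the premise, so finitely many conditions remain. *)
  have [K KP] := aX_unbounded (f e0 - f e)^-1.
  have [N NP] : for_large (fun d => forall k, (k < K)%N ->
      a ^+ k * (f e0 - f e) < 1 ->
      (k < d)%N /\ a ^+ k * (f e0 + (a ^+ d)^-1 - f e) <= 1).
    apply: for_large_forall_lt => k _.
    have [kg|kg] := ltP (a ^+ k * (f e0 - f e)) 1; last by exists 0%N.
    have [N NP] := @for_large_aXV_lt ((a ^+ k)^-1 - (f e0 - f e))
      ltac:(by rewrite subr_gt0 -[ltRHS]mul1r ltr_pdivlMr// mulrC).
    exists (maxn N k.+1) => d; rewrite geq_max => /andP[/NP Nd kd] _; split=> //.
    by rewrite mulrC -ler_pdivlMr// mul1r; lra.
  exists N => d Nd _ k kg; apply: NP => //; rewrite ltnNge; apply/negP => Kk.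
  have : (f e0 - f e)^-1 < a ^+ k.
    by apply: (lt_le_trans KP); rewrite ler_weXn2l// ltW.
  by rewrite -[ltLHS]mul1r ltr_pdivrMr ?subr_gt0//; lra.
have [N NP] := for_large_and evb (for_large_and (for_large_forall_lt evgt)
  (for_large_forall_lt evlt)).
exists N; split=> [d [e [ee0 fe _ fd _]]|d Nd].
  by have [_ [_ /(_ _ ee0 fe _ fd)[]]] := NP N (leqnn N).
have [db [dgt dlt]] := NP d Nd.
set t := (a ^+ d)^-1 in db dgt dlt.
have t0 : 0 < t by rewrite invr_gt0.
have [e1 e01 /andP[e1l e1r]] : exists2 e1, (e0.+1 <= e1)%N &
    f e0 + t / a < f e1 < f e0 + t.
  apply: f_dense; last by lra.
    by have := f_ge1 e0; have := divr_gt0 t0 a_gt0; lra.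
  by rewrite ltrD2l ltr_pdivrMr// ltr_pMr.
have fe01 : f e0 < f e1 by have := divr_gt0 t0 a_gt0; lra.
have below e : (e < e0)%N -> f e < f e1 -> f e < f e0.
  move=> ee0 ee1; rewrite lt_neqAle; apply/andP; split.
    by rewrite inj_eq// neq_ltn ee0.
  by rewrite leNgt; apply/negP => /(dgt _ ee0); lra.
have sameval e k : (e < e0)%N -> f e < f e0 ->
    (a ^+ k * (f e1 - f e) < 1) = (a ^+ k * (f e0 - f e) < 1).
  move=> ee0 fe; apply/idP/idP => [|/(dlt _ ee0 fe)[_]].
    by apply: le_lt_trans; rewrite ler_pM2l//; lra.
  by apply: lt_le_trans; rewrite ltr_pM2l//; lra.
have sameval' e k : (e < e0)%N -> f e < f e0 ->
    (1 <= a * a ^+ k * (f e1 - f e)) = (1 <= a * a ^+ k * (f e0 - f e)).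
  by move=> ee0 fe; rewrite -exprS !leNgt sameval.
have e0val : a ^+ d * (f e1 - f e0) < 1.
  by rewrite mulrC -ltr_pdivlMr// mul1r -/t; lra.
have e0val' : 1 <= a * a ^+ d * (f e1 - f e0).
  rewrite mulrC -ler_pdivrMr ?mulr_gt0// mul1r invfM mulrC -/t; lra.
exists e1 => x xd; split.
  move=> [e [ee1 fee1 erec ev ev']].
  have [ee0|ee0|ee0] := ltngtP e e0.
  - left; have fe := below _ ee0 fee1; exists e; split=> //.
    + by move=> e'' ee'' [h h']; apply: (erec _ ee''); split=> //; lra.
    + by rewrite -sameval.
    + by rewrite -sameval'.
  (* A best approximation later than [e0] has value at least [f e0], or [e0] would refute it; it is
     thus no farther from [f e1] than [f e0] is. *)
  - right; apply/eqP; rewrite eqn_leq xd -ltnS -(ltr_eXn2l a_gt1) exprS.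
    have fe : f e0 <= f e.
      by rewrite leNgt; apply/negP => h; apply: (erec _ ee0); split.
    rewrite -(ltr_pM2r (x := f e1 - f e0)) ?subr_gt0//.
    apply: (lt_le_trans e0val); apply: (le_trans ev').
    by rewrite ler_pM2l ?mulr_gt0//; lra.
  - right; apply/eqP; rewrite eqn_leq xd -ltnS -(ltr_eXn2l a_gt1) exprS.
    rewrite -(ltr_pM2r (x := f e1 - f e0)) ?subr_gt0//.
    by apply: (lt_le_trans e0val); rewrite -ee0.
move=> [[e [ee0 fe erec ev ev']]|->].
  exists e; split; [exact: ltn_trans ee0 e01|lra| |
    by rewrite sameval|by rewrite sameval'].
  move=> e'' ee'' [h h']; apply: (erec _ ee''); split=> //.
  by apply: below (ltn_trans ee'' ee0) _; lra.
exists e0; split=> // e'' ee'' [h h'].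
by have := dgt _ ee'' h; lra.
Qed.

Let flags_extend := flagged_extend record_extend.

Lemma nat_counts_to (n : nat) eps : 0 < eps -> counts_to eps n%:R.
Proof.
(* With this [h] and [r <= 1], the windows from [1 + i * h] to [1 + i * h + r * h] for [i <= n] all
   end at or below [b]. *)
move=> eps0; pose h := (b - 1) / n.+1%:R; pose r := Num.min eps 1.
have b1 : 1 < b by exact: le_lt_trans (f_ge1 0) (f_ltb 0).
have h0 : 0 < h by rewrite divr_gt0// subr_gt0.
have r0 : 0 < r by rewrite lt_min eps0 ltr01.
have r1 : r <= 1 by rewrite ge_min lexx orbT.
have re : r <= eps by rewrite ge_min lexx.
have rh0 : 0 < r * h by rewrite mulr_gt0.
have rhh : r * h <= h by rewrite ler_piMl// ltW.
have bh i : (i <= n)%N -> 1 + i%:R * h + r * h <= b.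
  move=> le_in; have : b = 1 + n.+1%:R * h.
    by rewrite /h mulrC divfK ?pnatr_eq0// addrC subrK.
  have : i.+1%:R * h <= n.+1%:R * h by rewrite ler_pM2r// ler_nat.
  by rewrite -natr1 mulrDl; lra.
suff main i : (i <= n)%N -> exists e s,
    chained e s (r * h) h /\
    (exists2 d, flagged e s d & 1 + i%:R * h < f d < 1 + i%:R * h + r * h).
  have [e [s [chain [d Fd dn]]]] := main n (leqnn n).
  have reh : r * h <= eps * h by rewrite ler_pM2r.
  exists e, s, h; split; last by exists d => //; rewrite ltr_norml; lra.
  move=> d1 /chain[?|[d' [? ? ?]]]; first by left; lra.
  by right; exists d'; split=> //; lra.
elim: i => [_|i IHi le_in].
  (* No index precedes 0, so the codes [0] and [0] flag nothing. *)
  have none x : ~ record 0 x by move=> [e' []].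
  have [N [_ ext]] := flags_extend 0 0.
  have [d Nd dP] := @f_dense 1 (1 + r * h) N (lexx _) ltac:(lra)
    ltac:(have := bh 0%N isT; lra).
  have [e [s F]] := ext d Nd; exists e, s; split=> [x|].
    by move=> /F[[/none]//|->]; left; rewrite ltr_norml; lra.
  by exists d; [apply/F; right|lra].
have [e [s [chain [d Fd dP]]]] := IHi (ltnW le_in).
have [N [FN ext]] := flags_extend e s.
pose p := f d + h.
(* The first bound gives the chain condition from [d], the second keeps the new value in window
   [i.+1]. *)
pose q := Num.min (p + r * h / a ^+ d) (1 + i.+1%:R * h + r * h).
have q1 : q <= p + r * h / a ^+ d by rewrite ge_min lexx.
have q2 : q <= 1 + i.+1%:R * h + r * h by rewrite ge_min lexx orbT.
have iS : i.+1%:R * h = i%:R * h + h by rewrite -natr1 mulrDl mul1r.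
have pq : p < q.
  rewrite lt_min ltrDl divr_gt0//=; rewrite /p; lra.
have [d1 Nd1 /andP[pd1 d1q]] := @f_dense p q N
  ltac:(have := f_ge1 d; rewrite /p; lra) pq (le_trans q2 (bh _ le_in)).
have [e' [s' F]] := ext d1 Nd1; exists e', s'; split.
  move=> x /F[/chain[|[d' [Fd' d'x ?]]]|->]; [by left| |].
    by right; exists d'; split=> //; apply/F; left.
  right; exists d; split; [by apply/F; left|exact: leq_trans (FN _ Fd) Nd1|].
  rewrite mulrC -ltr_pdivlMr// gtr0_norm; rewrite /p in pd1 q1; lra.
by exists d1; [apply/F; right|rewrite /p in pd1; lra].
Qed.

End Codes.

(** * Density *)

Section Density.
Variables (R : archiRealFieldType) (a b : R).
Hypothesis b0 : 0 < b.

(** Dirichlet's pigeonhole argument: among [n + 2] residues [y k] of [k * a] modulo [b], two fall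
    into the same one of [n + 1] boxes, whose width is below [del]. *)
Lemma small_combination del : 0 < del -> exists m (n : int),
  (0 < m)%N /\ `|m%:R * a + n%:~R * b| < del.
Proof.
move=> del0; pose n := Num.truncn (b / del).
have bn : b / n.+1%:R < del.
  by rewrite ltr_pdivrMr ?ltr0n// mulrC -ltr_pdivrMr// truncnS_gt.
pose l (k : nat) := Num.floor (k%:R * a / b).
pose y (k : nat) := k%:R * a - (l k)%:~R * b.
have yb k : 0 <= y k < b.
  have /andP[] := floor_itv (k%:R * a / b); rewrite -/(l k) intrD.
  by rewrite ler_pdivlMr// ltr_pdivrMr// mulrDl /y; lra.
pose g (k : 'I_n.+2) : 'I_n.+1 := inord (Num.truncn (y k * n.+1%:R / b)).
have gP (k : 'I_n.+2) : (g k)%:R * (b / n.+1%:R) <= y k <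
    (g k)%:R * (b / n.+1%:R) + b / n.+1%:R.
  have /andP[y0 ylt] := yb k.
  have /andP[] := truncn_itv (x := y k * n.+1%:R / b)
    ltac:(by rewrite divr_ge0 ?mulr_ge0// ltW).
  rewrite /g inordK; last first.
    rewrite truncn_lt_nat ?divr_ge0 ?mulr_ge0 ?(ltW b0)//.
    by rewrite ltr_pdivrMr// mulrC ltr_pM2l// ltr0n.
  set z := Num.truncn _; rewrite ler_pdivlMr// ltr_pdivrMr//.
  rewrite -ler_pdivrMr ?ltr0n// -ltr_pdivlMr ?ltr0n//.
  by rewrite -[z.+1%:R]natr1 !mulrDl mul1r -!mulrA => -> ->.
have /injectivePn[i [j ij gij]] : ~~ injectiveb g.
  by apply/negP => /injectiveP /leq_card; rewrite !card_ord ltnn.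
wlog {ij} ij : i j gij / (i < j)%N.
  move=> wl; move: ij; rewrite -(inj_eq val_inj) /= neq_ltn => /orP[] h.
    exact: (wl i j).
  exact: (wl j i).
exists (j - i)%N, (l i - l j); split; first by rewrite subn_gt0.
have -> : (j - i)%:R * a + (l i - l j)%:~R * b = y j - y i.
  by rewrite natrB ?(ltnW ij)// intrB /y; ring.
move: bn (gP i) (gP j); rewrite gij ltr_norml.
move: (b / _) (_%:R * _) => c z; lra.
Qed.

(** Shift the interval up by [L * b] beyond [N * t]: steps shorter than the interval cannot jump
    over it, and at least [N] of them are needed to reach it. *)
Lemma step_into_interval p q t N : 0 < t -> t < q - p ->
  exists j L : nat, (N <= j)%N /\ p < j%:R * t - L%:R * b < q.
Proof.
move=> t0 tpq; pose L := (Num.truncn ((N%:R * t + `|p|) / b)).+1.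
have hL : N%:R * t + `|p| < L%:R * b by rewrite -ltr_pdivrMr// truncnS_gt.
have Nt : 0 <= N%:R * t by rewrite mulr_ge0// ltW.
have pL : N%:R * t < p + L%:R * b by have := ler_norm (- p); rewrite normrN; lra.
pose j := Num.truncn ((p + L%:R * b) / t).
have /andP[j1 j2] : j%:R <= (p + L%:R * b) / t < j.+1%:R.
  by apply: truncn_itv; rewrite divr_ge0// ltW//; lra.
exists j.+1, L; split.
  rewrite -(ler_nat R); apply/ltW/(lt_trans _ j2).
  by rewrite ltr_pdivlMr.
rewrite ler_pdivlMr// in j1; rewrite ltr_pdivrMr// in j2.
by move: j2; rewrite -natr1 mulrDl; lra.
Qed.

Hypothesis ab_indep : forall m (n : int), (0 < m)%N -> m%:R * a + n%:~R * b != 0.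

(** Walk by a combination [t] shorter than the interval, nonzero by independence. For negative [t],
    reflect the interval. *)
Lemma kronecker p q N : p < q ->
  exists k (l : int), (N <= k)%N /\ p < k%:R * a + l%:~R * b < q.
Proof.
move=> pq; have [m [n [m0 tpq]]] := @small_combination (q - p) ltac:(lra).
set t := _ + _ in tpq; have t0 : t != 0 by exact: ab_indep.
have Nm j : (N <= j)%N -> (N <= j * m)%N by move/leq_trans; apply; rewrite leq_pmulr.
move: t0; rewrite neq_lt => /orP[] t0.
  rewrite ltr0_norm// in tpq.
  have [j [L [Nj jL]]] := @step_into_interval (- q) (- p) (- t) N
    ltac:(lra) ltac:(lra).
  exists (j * m)%N, (n * j%:Z + L%:Z); split; first exact: Nm.
  have -> : (j * m)%:R * a + (n * j%:Z + L%:Z)%:~R * b = j%:R * t + L%:R * b.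
    by rewrite natrM intrD intrM -!pmulrn /t; ring.
  lra.
rewrite gtr0_norm// in tpq.
have [j [L [Nj jL]]] := @step_into_interval p q t N t0 tpq.
exists (j * m)%N, (n * j%:Z - L%:Z); split; first exact: Nm.
have -> : (j * m)%:R * a + (n * j%:Z - L%:Z)%:~R * b = j%:R * t - L%:R * b.
  by rewrite natrM intrB intrM -!pmulrn /t; ring.
lra.
Qed.

End Density.

(** * Definability *)

Section Definability.
Variables (M : realFieldType) (A B : set M).
Implicit Types (P Q : (nat -> M) -> Prop) (t u : (nat -> M) -> M).

(** Semantic counterparts of terms and formulas: they produce the syntax from ordinary
    predicates. *)
Definition term_fun t := exists s, forall e, Defs.eval e s = t e.

Definition formula_pred P := exists phi, forall e, sat A B e phi <-> P e.

Lemma term_var i : term_fun (fun e => e i).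
Proof. by exists (TVar i). Qed.

Lemma term_zero : term_fun (fun=> 0).
Proof. by exists TZero. Qed.

Lemma term_one : term_fun (fun=> 1).
Proof. by exists TOne. Qed.

Lemma term_add t u : term_fun t -> term_fun u -> term_fun (fun e => t e + u e).
Proof. by move=> [r rE] [s sE]; exists (TAdd r s) => e /=; rewrite rE sE. Qed.

Lemma term_opp t : term_fun t -> term_fun (fun e => - t e).
Proof. by move=> [r rE]; exists (TOpp r) => e /=; rewrite rE. Qed.

Lemma term_mul t u : term_fun t -> term_fun u -> term_fun (fun e => t e * u e).
Proof. by move=> [r rE] [s sE]; exists (TMul r s) => e /=; rewrite rE sE. Qed.

Lemma formula_eq t u : term_fun t -> term_fun u ->
  formula_pred (fun e => t e = u e).
Proof. by move=> [r rE] [s sE]; exists (FEq r s) => e /=; rewrite rE sE. Qed.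

Lemma formula_lt t u : term_fun t -> term_fun u ->
  formula_pred (fun e => t e < u e).
Proof. by move=> [r rE] [s sE]; exists (FLt r s) => e /=; rewrite rE sE. Qed.

Lemma formula_A t : term_fun t -> formula_pred (fun e => A (t e)).
Proof. by move=> [r rE]; exists (FPredA r) => e /=; rewrite rE. Qed.

Lemma formula_B t : term_fun t -> formula_pred (fun e => B (t e)).
Proof. by move=> [r rE]; exists (FPredB r) => e /=; rewrite rE. Qed.

Lemma formula_not P : formula_pred P -> formula_pred (fun e => ~ P e).
Proof. by move=> [p pE]; exists (FNot p) => e /=; rewrite pE. Qed.

Lemma formula_and P Q : formula_pred P -> formula_pred Q ->
  formula_pred (fun e => P e /\ Q e).
Proof. by move=> [p pE] [q qE]; exists (FAnd p q) => e /=; rewrite pE qE. Qed.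

Lemma formula_or P Q : formula_pred P -> formula_pred Q ->
  formula_pred (fun e => P e \/ Q e).
Proof. by move=> [p pE] [q qE]; exists (FOr p q) => e /=; rewrite pE qE. Qed.

Lemma formula_imp P Q : formula_pred P -> formula_pred Q ->
  formula_pred (fun e => P e -> Q e).
Proof. by move=> [p pE] [q qE]; exists (FImp p q) => e /=; rewrite pE qE. Qed.

Lemma formula_exists (P : M -> (nat -> M) -> Prop) :
  formula_pred (fun e => P (e 0%N) (fun i => e i.+1)) ->
  formula_pred (fun e => exists x, P x e).
Proof.
move=> [p pE]; exists (FExists p) => e /=.
(* [scons x e] has head [x] and tail [e] up to conversion, so [pE] applies directly. *)
split=> -[x px]; exists x.
  exact: ((pE (scons x e)).1 px).
exact: ((pE (scons x e)).2 px).
Qed.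

Lemma formula_forall (P : M -> (nat -> M) -> Prop) :
  formula_pred (fun e => P (e 0%N) (fun i => e i.+1)) ->
  formula_pred (fun e => forall x, P x e).
Proof.
move=> [p pE]; exists (FForall p) => e /=.
split=> px x.
  exact: ((pE (scons x e)).1 (px x)).
exact: ((pE (scons x e)).2 (px x)).
Qed.

End Definability.

Ltac definability := cbn beta;
  lazymatch goal with
  | |- formula_pred _ _ (fun e => _ /\ _) => apply: formula_and; definability
  | |- formula_pred _ _ (fun e => _ \/ _) => apply: formula_or; definability
  | |- formula_pred _ _ (fun e => ~ _) => apply: formula_not; definability
  | |- formula_pred _ _ (fun e => exists x, _) =>
      apply: formula_exists; definability
  | |- formula_pred _ _ (fun e => _ = _) => apply: formula_eq; definability
  | |- formula_pred _ _ (fun e => is_true (_ < _)) =>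
      apply: formula_lt; definability
  | |- formula_pred _ _ (fun e => forall x, _) =>
      first [apply: formula_forall | apply: formula_imp]; definability
  | |- formula_pred ?A ?B (fun e => ?A _) => apply: formula_A; definability
  | |- formula_pred ?A ?B (fun e => ?B _) => apply: formula_B; definability
  | |- term_fun (fun e => 0) => exact: term_zero
  | |- term_fun (fun e => 1) => exact: term_one
  | |- term_fun (fun e => _ + _) => apply: term_add; definability
  | |- term_fun (fun e => - _) => apply: term_opp; definability
  | |- term_fun (fun e => _ * _) => apply: term_mul; definability
  | |- term_fun (fun e => e ?i) => exact: term_var
  end.

(** * First-order formulas for the codes *)

Section Transfer.
Variables (M : realFieldType) (A B : set M) (a b : M).
Implicit Types (x y z u v w d t h eps n : M).

(* First-order versions of [record], [flagged], [counts_to]: an index [k] becomes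
   [x = a ^+ k], accompanied by [u = f k] where needed. *)
Definition ge1_power d := A d /\ ~ (d < 1).

(** The language has only the strict order, so [1 <= u] is expressed as [~ (u < 1)]. *)
Definition mantissa x u := ge1_power x /\
  exists y, B y /\ u = x * y /\ ~ (u < 1) /\ u < b.

Definition fo_record x u d := exists x' u', mantissa x' u' /\ x' < x /\ u' < u /\
  (forall x'' u'', mantissa x'' u'' -> x'' < x' -> ~ (u' < u'' /\ u'' < u)) /\
  d * (u - u') < 1 /\ ~ (a * d * (u - u') < 1).

Definition fo_flagged x u y v d := ge1_power d /\ fo_record x u d /\
  exists w, ge1_power w /\ fo_record y v w /\ w < d /\
    forall z, ge1_power z -> fo_record x u z -> ~ (~ (z < w) /\ z < d).

Definition fo_close t h := - h < t /\ t < h.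

Definition fo_counts_to eps n := exists x u y v h, mantissa x u /\ mantissa y v /\
  (forall d t, mantissa d t -> fo_flagged x u y v d ->
    fo_close (t - 1) (eps * h) \/
    exists d' t', mantissa d' t' /\ fo_flagged x u y v d' /\ d' < d /\
      fo_close (d' * (t - t' - h)) (eps * h)) /\
  exists d t, mantissa d t /\ fo_flagged x u y v d /\
    fo_close (t - 1 - n * h) (eps * h).

Definition fo_integer n :=
  (forall eps, 0 < eps -> fo_counts_to eps n) \/
  (forall eps, 0 < eps -> fo_counts_to eps (- n)).

End Transfer.

Lemma formula_integer (M : realFieldType) (A B : set M) :
  formula_pred A B (fun e => fo_integer A B (e 1%N) (e 2%N) (e 0%N)).
Proof.
rewrite /fo_integer /fo_counts_to /fo_close /fo_flagged /fo_record.
rewrite /mantissa /ge1_power.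
definability.
Qed.

(** * Meaning of the formulas on powers, and definability of the integers *)

Section Interpretation.
Variables (M : realFieldType) (a b : M) (l : nat -> int).
Hypotheses (a1 : 1 < a) (b1 : 1 < b).
Local Notation A := (zpowers a).
Local Notation B := (zpowers b).
Let f k := a ^+ k * b ^ l k.
Hypothesis f_itv : forall k, 1 <= f k < b.

Let a0 : 0 < a. Proof. exact: lt_trans ltr01 a1. Qed.
Let b0 : 0 < b. Proof. exact: lt_trans ltr01 b1. Qed.

Lemma ge1_powerP d : ge1_power A d <-> exists k, d = a ^+ k.
Proof.
split=> [[[k ->] /negP]|[k ->]]; last first.
  by split; [exists k%:Z|apply/negP; rewrite -leNgt exprn_ege1// ltW].
rewrite -leNgt -[1](expr0z a) ler_eXz2l//; case: k => // k _.
by exists k.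
Qed.

(** Only one power of [b] brings [a ^+ k] into the interval from 1 to [b], so the formula recovers
    [f k] without mentioning [l]. *)
Lemma mantissaP x u : mantissa A B b x u <-> exists k, x = a ^+ k /\ u = f k.
Proof.
split=> [[/ge1_powerP[k xk] [_ [[m ->] [um [/negP u1 ub]]]]]|[k [-> ->]]];
  last first.
  split; first by apply/ge1_powerP; exists k.
  exists (b ^ l k); split; first by exists (l k).
  by have /andP[? ?] := f_itv k; split=> //; split=> //; apply/negP; rewrite -leNgt.
exists k; split=> //; rewrite um xk; congr (_ * b ^ _).
have ak : 0 < a ^+ k by rewrite exprn_gt0.
rewrite -leNgt in u1.
have bS (i : int) : b ^ (i + 1) = b ^ i * b by rewrite expfzDr ?expr1z// gt_eqF.
(* An exponent keeping the product below [b] never exceeds one keeping it at least 1; used in both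
   directions. *)
have sep i j : a ^+ k * b ^ i < b -> 1 <= a ^+ k * b ^ j -> (i <= j)%R.
  move=> ib j1; rewrite -ltzD1 -(ltr_eXz2l b1) bS.
  rewrite -(ltr_pM2l ak) mulrA; apply: (lt_le_trans ib).
  by rewrite ler_peMl// ltW.
have /andP[f1 fb] := f_itv k; rewrite um xk in u1 ub.
by apply/eqP; rewrite eq_le !sep.
Qed.

Lemma fo_recordP e d :
  fo_record A B a b (a ^+ e) (f e) (a ^+ d) <-> record a f e d.
Proof.
split.
  move=> [_ [_ [/mantissaP[k [-> ->]] [ke [fk [rec [dl /negP dg]]]]]]].
  exists k; split=> //; first by rewrite -(ltr_eXn2l a1).
    move=> k' k'k; apply: (rec (a ^+ k')); last by rewrite ltr_eXn2l.
    by apply/mantissaP; exists k'.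
  by rewrite leNgt.
move=> [k [ke fk rec dl dg]]; exists (a ^+ k), (f k); split.
  by apply/mantissaP; exists k.
do ![split; rewrite ?ltr_eXn2l//]; last by apply/negP; rewrite -leNgt.
by move=> _ _ /mantissaP[k' [-> ->]]; rewrite ltr_eXn2l//; exact: rec.
Qed.

Lemma fo_flaggedP e s d :
  fo_flagged A B a b (a ^+ e) (f e) (a ^+ s) (f s) (a ^+ d) <->
  flagged (record a f) e s d.
Proof.
split.
  move=> [_ [/fo_recordP ed [_ [/ge1_powerP[v ->] [/fo_recordP sv [vd gap]]]]]].
  split=> //; exists v; split=> //; first by rewrite -(ltr_eXn2l a1).
  move=> w /fo_recordP ew [vw wd]; apply: (gap (a ^+ w)) => //.
    by apply/ge1_powerP; exists w.
  by rewrite !ltr_eXn2l// ltnNge vw.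
move=> [ed [v [sv vd gap]]]; split; first by apply/ge1_powerP; exists d.
split; first exact/fo_recordP.
exists (a ^+ v); split; first by apply/ge1_powerP; exists v.
split; first exact/fo_recordP.
split; first by rewrite ltr_eXn2l.
move=> _ /ge1_powerP[w ->] /fo_recordP ew; rewrite !ltr_eXn2l// => -[/negP vw wd].
by apply: (gap w ew); rewrite leqNgt.
Qed.

Lemma fo_closeP (t h : M) : fo_close t h <-> `|t| < h.
Proof. by rewrite ltr_norml; split=> [[-> ->]|/andP[]]. Qed.

Lemma fo_counts_toP eps n : fo_counts_to A B a b eps n <-> counts_to a f eps n.
Proof.
have norma k (t : M) : a ^+ k * `|t| = `|a ^+ k * t|.
  by rewrite normrM [`|a ^+ k|]gtr0_norm ?exprn_gt0.
split.
  move=> [_ [_ [_ [_ [h [/mantissaP[e [-> ->]] [/mantissaP[s [-> ->]]]]]]]]].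
  move=> [chain [_ [_ [/mantissaP[d [-> ->]] [/fo_flaggedP Fd /fo_closeP dn]]]]].
  exists e, s, h; split; last by exists d.
  move=> k /fo_flaggedP Fk.
  have Gk : mantissa A B b (a ^+ k) (f k) by apply/mantissaP; exists k.
  case: (chain _ _ Gk Fk) => [/fo_closeP|]; first by left.
  move=> [_ [_ [/mantissaP[k' [-> ->]] [/fo_flaggedP Fk' [k'k /fo_closeP kk']]]]].
  by right; exists k'; split; rewrite -?(ltr_eXn2l a1) ?norma.
move=> [e [s [h [chain [d Fd dn]]]]].
exists (a ^+ e), (f e), (a ^+ s), (f s), h.
split; first by apply/mantissaP; exists e.
split; first by apply/mantissaP; exists s.
split; last first.
  exists (a ^+ d), (f d); split; first by apply/mantissaP; exists d.
  by split; [exact/fo_flaggedP|exact/fo_closeP].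
move=> _ _ /mantissaP[k [-> ->]] /fo_flaggedP /chain[?|].
  by left; apply/fo_closeP.
move=> [k' [Fk' k'k kk']]; right; exists (a ^+ k'), (f k').
split; first by apply/mantissaP; exists k'.
split; first exact/fo_flaggedP.
by split; [rewrite ltr_eXn2l|apply/fo_closeP; rewrite -norma].
Qed.

Hypothesis aX_unbounded : forall x, exists d, x < a ^+ d.
Hypothesis ab_indep : forall m (n : int), (0 < m)%N -> a ^+ m * b ^ n != 1.
Hypothesis ab_dense : forall p q N, 1 <= p -> p < q -> q <= b ->
  exists k (n : int), (N <= k)%N /\ p < a ^+ k * b ^ n < q.

Let f_inj : injective f.
Proof.
suff lt_neq i j : (i < j)%N -> f i <> f j.
  by move=> i j fij; case: (ltngtP i j) => // /lt_neq[].
move=> ij fij; have /eqP[] := @ab_indep (j - i) (l j - l i)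
  ltac:(by rewrite subn_gt0).
have fi0 : f i != 0 by rewrite gt_eqF// (lt_le_trans ltr01)//; case/andP: (f_itv i).
apply: (mulfI fi0); rewrite mulr1 [RHS]fij /f mulrACA -exprD subnKC ?(ltnW ij)//.
by rewrite -expfzDr ?gt_eqF// addrC subrK.
Qed.

Let f_dense p q N : 1 <= p -> p < q -> q <= b ->
  exists2 k, (N <= k)%N & p < f k < q.
Proof.
move=> p1 pq qb; have [k [n [Nk /andP[pk kq]]]] := ab_dense N p1 pq qb.
(* A monomial lying between 1 and [b] is already a mantissa, hence a value of [f]. *)
have [k' [kk' fk']] : exists k', a ^+ k = a ^+ k' /\ a ^+ k * b ^ n = f k'.
  apply/mantissaP; split; first by apply/ge1_powerP; exists k.
  exists (b ^ n); split; first by exists n.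
  by split=> //; split; [apply/negP; rewrite -leNgt; lra|lra].
exists k'; first by rewrite -(ler_eXn2l a1) -kk' ler_eXn2l.
by rewrite -fk' pk.
Qed.

Lemma definable_integers : definable A B (@integers M).
Proof.
have [phi phiP] := formula_integer A B.
(* Behind the argument, the parameters [a] and [b] become variables 1 and 2, as in
   [formula_integer]. *)
exists phi, (scons a (scons b (fun=> 0))); rewrite predeqE => x /=.
rewrite phiP /=.
have f1 k : 1 <= f k by case/andP: (f_itv k).
have fb k : f k < b by case/andP: (f_itv k).
have counts (n : nat) eps : 0 < eps -> fo_counts_to A B a b eps n%:R.
  by move=> eps0; apply/fo_counts_toP; apply: (@nat_counts_to M a b f).
have counted y : (forall eps, 0 < eps -> fo_counts_to A B a b eps y) ->
    exists k : nat, y = k%:R.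
  by move=> cy; apply: (@counts_to_nat M a f) => // eps /cy /fo_counts_toP.
split=> [[[k|k] ->]|[/counted[k ->]|/counted[k xk]]].
- by left=> eps; exact: counts.
- by right=> eps; rewrite NegzE mulrNz opprK; exact: counts.
- by exists k%:Z.
- by exists (- k%:Z); rewrite mulrNz -pmulrn -xk opprK.
Qed.

End Interpretation.

(** * Logarithms and powers of real numbers *)

Section RealPowers.
Variable R : realType.
Implicit Types x y : R.

Lemma ln_exprz x (n : int) : 0 < x -> ln (x ^ n) = n%:~R * ln x.
Proof. by move=> x0; rewrite -powR_intmul ?ltW// ln_powR. Qed.

Lemma ln_monomial x y m (n : int) : 0 < x -> 0 < y ->
  ln (x ^+ m * y ^ n) = m%:R * ln x + n%:~R * ln y.
Proof.
move=> x0 y0; rewrite lnM ?posrE ?exprn_gt0 ?exprz_gt0// lnXn//.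
by rewrite ln_exprz// mulr_natl.
Qed.

(** A relation with [m != 0] would give [logb x y = - (m / n)], where [n] cannot vanish because
    [ln x] does not. *)
Lemma logb_irrational_indep x y : irrational (logb x y) ->
  forall m n : int, m != 0 -> m%:~R * ln x + n%:~R * ln y != 0.
Proof.
move=> irr m n m0; apply/eqP => mn0.
(* If [ln x = 0], then [logb x y] is 0 by the convention [0^-1 = 0], so rational. *)
have [x0|x0] := eqVneq (ln x) 0.
  by apply: irr; exists 0 => //; rewrite rmorph0 /logb x0 invr0 mulr0.
have n0 : n != 0.
  apply: contraNneq m0 => n0; move/eqP: mn0; rewrite n0 mul0r addr0 mulf_eq0.
  by rewrite (negPf x0) orbF intr_eq0.
apply: irr; exists (- (m%:~R / n%:~R)) => //.
rewrite rmorphN rmorphM /= fmorphV !ratr_int /logb.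
have nR : n%:~R != 0 :> R by rewrite intr_eq0.
apply: (mulIf x0); rewrite divfK//; apply: (mulfI nR).
by move/eqP: mn0; rewrite addrC addr_eq0 => /eqP ->; field.
Qed.

Lemma exprn_unbounded x z : 1 < x -> exists d, z < x ^+ d.
Proof.
move=> x1; have x0 : 0 < x by exact: lt_trans ltr01 x1.
have [z0|z0] := leP z 0; first by exists 0%N; rewrite expr0; lra.
exists (Num.truncn (ln z / ln x)).+1.
rewrite -ltr_ln ?posrE ?exprn_gt0// lnXn// -mulr_natl -ltr_pdivrMr ?ln_gt0//.
exact: truncnS_gt.
Qed.

(** Logarithms turn the bounds into the defining inequalities of the floor of [k * ln x / ln y]. *)
Lemma exprn_reduce x y k : 0 < x -> 1 < y ->
  exists l : int, 1 <= x ^+ k * y ^ l < y.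
Proof.
move=> x0 y1; have y0 : 0 < y by exact: lt_trans ltr01 y1.
exists (- Num.floor (k%:R * ln x / ln y)).
have xy0 : 0 < x ^+ k * y ^ (- Num.floor (k%:R * ln x / ln y)).
  by rewrite mulr_gt0 ?exprn_gt0 ?exprz_gt0.
rewrite -ler_ln ?posrE// -ltr_ln ?posrE// ln_monomial// ln1.
have := floor_itv (k%:R * ln x / ln y).
rewrite ler_pdivlMr ?ln_gt0// ltr_pdivrMr ?ln_gt0//.
rewrite intrD mulrNz mulrDl mulNr mul1r => /andP[h1 h2].
by rewrite subr_ge0 h1 ltrBlDl h2.
Qed.

(** Since [ln] is increasing, this is [kronecker] for [ln x] and [ln y]. *)
Lemma monomial_dense x y : 1 < x -> 1 < y ->
  (forall m (n : int), (0 < m)%N -> m%:R * ln x + n%:~R * ln y != 0) ->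
  forall p q N, 0 < p -> p < q ->
  exists k (n : int), (N <= k)%N /\ p < x ^+ k * y ^ n < q.
Proof.
move=> x1 y1 indep p q N p0 pq.
have x0 : 0 < x by exact: lt_trans ltr01 x1.
have y0 : 0 < y by exact: lt_trans ltr01 y1.
have q0 : 0 < q by exact: lt_trans pq.
have [k [n [Nk kn]]] := kronecker (ln_gt0 y1) indep N
  (p := ln p) (q := ln q) ltac:(by rewrite ltr_ln).
exists k, n; split=> //; rewrite -ln_monomial// in kn.
by rewrite !ltr_ln ?posrE ?mulr_gt0 ?exprn_gt0 ?exprz_gt0 in kn.
Qed.

End RealPowers.

Lemma zpowersV (M : realFieldType) (x : M) : zpowers x^-1 = zpowers x.
Proof.
rewrite predeqE => z; split=> -[k ->]; exists (- k).
  by rewrite exprz_inv.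
by rewrite exprz_inv opprK.
Qed.

(** * Descent from the reals to the subfield *)

Section MainTheorem.
Variables (R : realType) (K : divringClosed R).
Implicit Types x y : subfield K.

Lemma val_monomial x y m (n : int) :
  \val (x ^+ m * y ^ n) = \val x ^+ m * \val y ^ n.
Proof. by rewrite rmorphM rmorphXn fmorphXz. Qed.

(** Inverting a base below 1 keeps its set of powers and negates its logarithm; [s] records the
    sign. *)
Lemma zpowers_gt1 x : 0 < x -> ln (\val x) != 0 ->
  exists y (s : int), [/\ 1 < y, zpowers y = zpowers x, s != 0 &
    ln (\val y) = s%:~R * ln (\val x)].
Proof.
move=> x0 lnx; have [x1|x1|xE] := ltgtP x 1.
- exists x^-1, (-1).
  split; [by rewrite invf_gt1|exact: zpowersV|by []|].
  by rewrite fmorphV lnV ?posrE// mulN1r.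
- by exists x, 1; split=> //; rewrite mul1r.
- by move: lnx; rewrite xE rmorph1 ln1 eqxx.
Qed.

(** Order and powers in [subfield K] agree with those in [R], and monomials in [x] and [y] stay in
    [K], so the estimates over [R] descend. *)
Lemma definable_integers_gt1 x y : 1 < x -> 1 < y ->
  (forall m (n : int), (0 < m)%N ->
    m%:R * ln (\val x) + n%:~R * ln (\val y) != 0) ->
  definable (zpowers x) (zpowers y) (@integers _).
Proof.
move=> x1 y1 indep.
have vx1 : 1 < \val x by exact: x1.
have vy1 : 1 < \val y by exact: y1.
have vx0 : 0 < \val x by exact: lt_trans ltr01 vx1.
have vy0 : 0 < \val y by exact: lt_trans ltr01 vy1.
have red k : exists l : int, 1 <= x ^+ k * y ^ l < y.
  have [l lP] := exprn_reduce k vx0 vy1.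
  by exists l; rewrite -val_monomial in lP.
have [l lP] := choice red.
apply: (@definable_integers _ x y l) => //.
- move=> z; have [d dP] := exprn_unbounded (\val z) vx1.
  by exists d; rewrite -rmorphXn in dP.
- move=> m n m0; apply: contra (indep m n m0) => /eqP xy.
  by rewrite -ln_monomial// -val_monomial xy rmorph1 ln1.
- move=> p q N p1 pq _.
  have vp : 0 < \val p by exact: lt_le_trans ltr01 p1.
  have [k [n [Nk knP]]] := monomial_dense vx1 vy1 indep N vp pq.
  by exists k, n; split=> //; rewrite -val_monomial in knP.
Qed.

End MainTheorem.

Theorem theoremC (R : realType) (K : divringClosed R)
    (alpha beta : subfield K)
    (alpha_gt0 : 0 < alpha) (beta_gt0 : 0 < beta)
    (log_irr : irrational (logb (\val alpha) (\val beta))) :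
  definable (zpowers alpha) (zpowers beta) (@integers _).
Proof.
have lna : ln (\val alpha) != 0.
  apply/eqP => a0; apply: log_irr; exists 0 => //.
  by rewrite rmorph0 /logb a0 invr0 mulr0.
have lnb : ln (\val beta) != 0.
  apply/eqP => b0; apply: log_irr; exists 0 => //.
  by rewrite rmorph0 /logb b0 mul0r.
have [x [s [x1 <- s0 lnx]]] := zpowers_gt1 alpha_gt0 lna.
have [y [t [y1 <- t0 lny]]] := zpowers_gt1 beta_gt0 lnb.
apply: definable_integers_gt1 => // m n m0.
(* The signs [s] and [t] are absorbed into the integer coefficients, and [m * s] stays nonzero. *)
rewrite lnx lny !mulrA pmulrn -!intrM.
by apply: logb_irrational_indep => //; rewrite mulf_neq0// -lt0n.
Qed.
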